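(* Let $\Gamma$ be an additive subgroup of $\mathbb{C}$ containing $1$, and let $M$ be a $\mathcal{V}_\Gamma$-module. If the restriction of $M$ to $\mathbb{C}[L_0]$ is a free $\mathbb{C}[L_0]$-module of rank $1$, then $C$ acts on $M$ by zero and $M\cong\Omega_\Gamma(f,\alpha)$ for some $f\in\Gamma^{\vee}$ and $\alpha\in\mathbb{C}$.
   Context: The base field is $\mathbb{C}$. $\Gamma^{\vee}$ is the set of group homomorphisms $\Gamma\to\mathbb{C}^*$. $\mathcal{V}_\Gamma$ is the Lie algebra with basis $\{L_m\}_{m\in\Gamma}\cup\{C\}$ and brackets $[L_m,C]=0$, $[L_m,L_n]=(m-n)L_{m+n}+\delta_{m+n,0}\frac{m^3-m}{12}C$. The polynomial algebra $\mathbb{C}[L_0]$ is identified with $\mathcal{U}(\mathbb{C}L_0)\subset\mathcal{U}(\mathcal{V}_\Gamma)$. For $f\in\Gamma^\vee$, $\alpha\in\mathbb{C}$, $\Omega_\Gamma(f,\alpha)$ is the vector space $\mathbb{C}[L_0]$ with the action $L_mP(L_0)=f(m)(L_0+m\alpha)P(L_0+m)$ for $m\in\Gamma$, $P\in\mathbb{C}[L_0]$, viewed as a $\mathcal{V}_\Gamma$-module with $C$ acting by zero. *)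

(* Defs.v *)
From HB Require Import structures.
From mathcomp Require Import all_boot all_order all_algebra.
From mathcomp Require Import finmap.
From mathcomp Require Import monalg.
From mathcomp Require Import ring.

Set Implicit Arguments.
Unset Strict Implicit.
Unset Printing Implicit Defensive.

Import GRing.Theory Num.Theory.
Local Open Scope ring_scope.

HB.mixin Record Lmodule_isLieAlgebra (K : fieldType) g of GRing.Lmodule K g := {
  bracket : g -> g -> g;
  bracket_linear_l : forall y, linear (bracket^~ y);
  bracket_linear_r : forall x, linear (bracket x);
  bracket_alt : forall x, bracket x x = 0;
  bracket_jacobi : forall x y z,
    bracket x (bracket y z) + bracket y (bracket z x)
      + bracket z (bracket x y) = 0
}.

#[short(type="lieAlgType")]
HB.structure Definition LieAlgebra (K : fieldType) :=
  { g of GRing.Lmodule K g & Lmodule_isLieAlgebra K g }.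

HB.mixin Record Lmodule_isLieModule (K : fieldType) (g : lieAlgType K) M
    of GRing.Lmodule K M := {
  act : g -> M -> M;
  act_linear_l : forall v, linear (act^~ v);
  act_linear_r : forall x, linear (act x);
  act_bracket : forall x y v,
    act (bracket x y) v = act x (act y v) - act y (act x v)
}.

#[short(type="lieModType")]
HB.structure Definition LieModule (K : fieldType) (g : lieAlgType K) :=
  { M of GRing.Lmodule K M & Lmodule_isLieModule K g M }.

Arguments LieModule.type {K} g.

Definition lieMod_isomorphic (K : fieldType) (g : lieAlgType K)
    (M N : lieModType g) : Prop :=
  exists phi : {linear M -> N},
    bijective phi /\ forall (x : g) (v : M), phi (act x v) = act x (phi v).

Definition free_of_rank (A : nzRingType) (N : lmodType A) (n : nat) : Prop :=
  exists b : 'I_n -> N, forall w : N,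
    exists! c : {ffun 'I_n -> A}, w = \sum_(i < n) c i *: b i.

(* The restriction of a g-module M to K[x] = U(Kx), for x in g:
   the underlying group of M, on which a polynomial p acts as p(x). *)
Definition restr (K : fieldType) (g : lieAlgType K) (x : g)
  (M : lieModType g) : Type := M.

Section Restriction.
Variables (K : fieldType) (g : lieAlgType K) (x : g) (M : lieModType g).

HB.instance Definition _ := GRing.Zmodule.on (restr x M).

Definition restr_scale (p : {poly K}) (v : restr x M) : restr x M :=
  \sum_(i < size p) p`_i *: (iter i (act x) v : M).

Let it i (v : M) : M := iter i (act x) v.

Let itZD i a v w : it i (a *: v + w) = a *: it i v + it i w.
Proof. by elim: i => //= i ->; rewrite act_linear_r. Qed.

Let restr_scaleE n (p : {poly K}) v : (size p <= n)%N ->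
  restr_scale p v = \sum_(i < n) p`_i *: it i v.
Proof.
move=> le_pn; rewrite /restr_scale (big_ord_widen n (fun i => p`_i *: it i v)) //.
rewrite big_mkcond; apply: eq_bigr => i _; case: ltnP => // le_pi.
by rewrite nth_default // scale0r.
Qed.

Let restr_scaleDl v : {morph restr_scale^~ v : p q / p + q}.
Proof.
move=> p q; set n := maxn (size p) (size q).
rewrite !(@restr_scaleE n) ?leq_maxl ?leq_maxr ?size_polyD //.
rewrite -big_split; apply: eq_bigr => i _ /=.
by rewrite coefD scalerDl.
Qed.

Let restr_scaleDr : right_distributive restr_scale +%R.
Proof.
move=> p v w; rewrite /restr_scale -big_split; apply: eq_bigr => i _ /=.
have := itZD i 1 v w; rewrite !scale1r /it => ->.
by rewrite scalerDr.
Qed.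

Let restr_scaleC c v : restr_scale c%:P v = c *: (v : M).
Proof.
by rewrite (@restr_scaleE 1) ?size_polyC_leq1 // big_ord1 coefC eqxx.
Qed.

Let restr_scale1 : left_id 1 restr_scale.
Proof. by move=> v; rewrite -polyC1 restr_scaleC scale1r. Qed.

Let restr_scaleCM c p v : restr_scale (c%:P * p) v = c *: (restr_scale p v : M).
Proof.
rewrite (@restr_scaleE (size p)); last first.
  by rewrite mul_polyC size_scale_leq.
rewrite scaler_sumr; apply: eq_bigr => i _.
by rewrite coefCM scalerA.
Qed.

Let act_sum n (F : 'I_n -> M) : act x (\sum_i F i) = \sum_i act x (F i).
Proof.
pose lx := GRing.isLinear.Build K M M *:%R (act x) (act_linear_r x).
pose f : {linear M -> M} := HB.pack (act x) lx.
exact: (raddf_sum f).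
Qed.

Let actZ a v : act x (a *: v) = a *: act x v :> M.
Proof.
pose lx := GRing.isLinear.Build K M M *:%R (act x) (act_linear_r x).
pose f : {linear M -> M} := HB.pack (act x) lx.
exact: (linearZZ f).
Qed.

Let restr_scaleXM p v : restr_scale (p * 'X) v = act x (restr_scale p v : M).
Proof.
rewrite (@restr_scaleE (size p).+1); last first.
  by rewrite (leq_trans (size_polyMleq _ _)) // size_polyX addn2.
rewrite big_ord_recl coefMX eqxx scale0r add0r /restr_scale act_sum.
by apply: eq_bigr => i _; rewrite coefMX actZ.
Qed.

Let restr_scaleA p q v :
  restr_scale p (restr_scale q v) = restr_scale (p * q) v.
Proof.
elim/poly_ind: p => [|p c IHp].
  by rewrite mul0r /restr_scale size_poly0 !big_ord0.
rewrite mulrDl !restr_scaleDl restr_scaleCM restr_scaleC.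
by rewrite -mulrA (mulrC 'X) mulrA !restr_scaleXM IHp.
Qed.

HB.instance Definition _ := GRing.Zmodule_isLmodule.Build {poly K} (restr x M)
  restr_scaleA restr_scale1 restr_scaleDr restr_scaleDl.

Lemma restr_scaleX (v : restr x M) : 'X *: v = (act x (v : M) : restr x M).
Proof. by have := restr_scaleXM 1 v; rewrite mul1r restr_scale1. Qed.

End Restriction.

Definition subgrp (K : fieldType) (Gamma : zmodClosed K) : Type :=
  {m : K | m \in Gamma}.

HB.instance Definition _ (K : fieldType) (Gamma : zmodClosed K) :=
  SubChoice.on (subgrp Gamma).
HB.instance Definition _ (K : fieldType) (Gamma : zmodClosed K) :=
  [SubChoice_isSubZmodule of subgrp Gamma by <:].

(* Gamma^vee: the group homomorphisms from Gamma to the units of K *)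
Record dual (K : fieldType) (Gamma : zmodClosed K) := Dual {
  dual_fun :> subgrp Gamma -> K;
  dual_neq0 : forall m, dual_fun m != 0;
  dualD : forall m n, dual_fun (m + n) = dual_fun m * dual_fun n
}.

Section LinearExtension.
Variables (K : fieldType) (I : choiceType) (N : lmodType K).

(* The linear map sending the basis vector << i >> to h i. *)
Definition lext (h : I -> N) (x : {malg K[I]}) : N :=
  \sum_(i <- msupp x) x@_i *: h i.

Lemma lextEw (d : {fset I}) h x : (msupp x `<=` d)%fset ->
  lext h x = \sum_(i <- d) x@_i *: h i.
Proof.
move=> le_xd; rewrite /lext (big_fset_incl _ le_xd) // => i _ Nxi.
by rewrite mcoeff_outdom // scale0r.
Qed.

Lemma lext_linear h : linear (lext h).
Proof.
move=> a x y; set d := (msupp x `|` msupp y)%fset.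
have xd : (msupp x `<=` d)%fset by rewrite fsubsetUl.
have yd : (msupp y `<=` d)%fset by rewrite fsubsetUr.
rewrite !(@lextEw d) //; last first.
  apply: fsubset_trans (msuppD_le _ _) _; apply: fsetSU; exact: msuppZ_le.
rewrite scaler_sumr -big_split; apply: eq_bigr => i _ /=.
by rewrite mcoeffD mcoeffZ scalerDl scalerA.
Qed.

HB.instance Definition _ h :=
  GRing.isLinear.Build K {malg K[I]} N *:%R (lext h) (lext_linear h).

Lemma lextU h i : lext h << i >> = h i.
Proof.
rewrite (@lextEw [fset i]%fset) ?msuppU_le // big_seq_fset1 mcoeffUU.
by rewrite scale1r.
Qed.

Lemma lext_hlinear x a h1 h2 :
  lext (fun i => a *: h1 i + h2 i) x = a *: lext h1 x + lext h2 x.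
Proof.
rewrite /lext scaler_sumr -big_split; apply: eq_bigr => i _ /=.
by rewrite scalerDr !scalerA mulrC.
Qed.

Lemma eq_lext h1 h2 x : h1 =1 h2 -> lext h1 x = lext h2 x.
Proof. by move=> eqh; apply: eq_bigr => i _; rewrite eqh. Qed.

Lemma linear_lext (f : {malg K[I]} -> N) : linear f ->
  forall x, f x = lext (fun i => f << i >>) x.
Proof.
move=> lf x.
pose lfm := GRing.isLinear.Build K {malg K[I]} N *:%R f lf.
pose F : {linear {malg K[I]} -> N} := HB.pack f lfm.
rewrite {1}[x]monalgE -[LHS]/(F _) raddf_sum /lext; apply: eq_bigr => i _.
rewrite -[RHS](linearZZ F); congr f.
by apply/malgP => k; rewrite mcoeffZ !mcoeffU; case: eqP; rewrite ?mulr1 ?mulr0.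
Qed.

Lemma linear_eq (f h : {malg K[I]} -> N) : linear f -> linear h ->
  (forall i, f << i >> = h << i >>) -> f =1 h.
Proof.
move=> lf lh fh x; rewrite (linear_lext lf) (linear_lext lh).
by apply: eq_lext.
Qed.

Lemma linear_eq0 (f : {malg K[I]} -> N) : linear f ->
  (forall i, f << i >> = 0) -> forall x, f x = 0.
Proof.
move=> lf f0 x; rewrite (linear_lext lf) /lext big1 // => i _.
by rewrite f0 scaler0.
Qed.

End LinearExtension.

(* The vector space with basis L_m = << Some m >>, for m in Gamma,
   and C = << None >>. *)
Definition Vir (K : numFieldType) (Gamma : zmodClosed K) : Type :=
  {malg K[option (subgrp Gamma)]}.

HB.instance Definition _ (K : numFieldType) (Gamma : zmodClosed K) :=
  GRing.Lmodule.on (Vir Gamma).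

Section Virasoro.
Variables (K : numFieldType) (Gamma : zmodClosed K).

Definition VirL (m : subgrp Gamma) : Vir Gamma := << Some m >>.
Definition VirC : Vir Gamma := << None >>.

Definition Vir_bracket_basis (i j : option (subgrp Gamma)) : Vir Gamma :=
  match i, j with
  | Some m, Some n =>
      (val m - val n) *: VirL (m + n)
      + ((m + n == 0)%:R * ((val m ^+ 3 - val m) / 12)) *: VirC
  | _, _ => 0
  end.

Definition Vir_bracket (x y : Vir Gamma) : Vir Gamma :=
  lext (fun i => lext (Vir_bracket_basis i) y) x.

Let Vir_bracket_linear_l y : linear (Vir_bracket^~ y).
Proof. exact: lext_linear. Qed.

Let Vir_bracket_linear_r x : linear (Vir_bracket x).
Proof.
move=> a y z; rewrite /Vir_bracket -lext_hlinear.
by apply: eq_lext => i; rewrite lext_linear.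
Qed.

Let Vir_bracketUU i j : Vir_bracket << i >> << j >> = Vir_bracket_basis i j.
Proof. by rewrite /Vir_bracket !lextU. Qed.

Let bracket_basisC i j : Vir_bracket_basis i j = - Vir_bracket_basis j i.
Proof.
case: i j => [m|] [n|] /=; rewrite ?oppr0 //.
rewrite (addrC n m) opprD -!scaleNr opprB.
suff -> : - ((m + n == 0)%:R * ((val n ^+ 3 - val n) / 12))
        = (m + n == 0)%:R * ((val m ^+ 3 - val m) / 12) by [].
have [/eqP|] := eqVneq (m + n) 0; last by rewrite !mul0r oppr0.
rewrite addr_eq0 => /eqP ->; rewrite !mul1r raddfN.
by ring.
Qed.

Let linearDl (f h : Vir Gamma -> Vir Gamma) :
  linear f -> linear h -> linear (fun x => f x + h x).
Proof. by move=> lf lh a x y; rewrite lf lh scalerDr addrACA. Qed.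

Let linear_comp (f h : Vir Gamma -> Vir Gamma) :
  linear f -> linear h -> linear (fun x => f (h x)).
Proof. by move=> lf lh a x y; rewrite lh lf. Qed.

Let linearN (f : Vir Gamma -> Vir Gamma) :
  linear f -> linear (fun x => - f x).
Proof. by move=> lf a x y; rewrite lf opprD scalerN. Qed.

Let Vir_bracketC x y : Vir_bracket x y = - Vir_bracket y x.
Proof.
move: x; apply: linear_eq => [||i].
- exact: Vir_bracket_linear_l.
- exact/linearN/Vir_bracket_linear_r.
move: y; apply: linear_eq => [||j].
- exact: Vir_bracket_linear_r.
- exact/linearN/Vir_bracket_linear_l.
by rewrite !Vir_bracketUU bracket_basisC.
Qed.

Let Vir_bracket_alt x : Vir_bracket x x = 0.
Proof.
have two_neq0 : (2 : K) != 0 by rewrite pnatr_eq0.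
apply: (scalerI two_neq0); rewrite scaler0 scaler_nat mulr2n.
by rewrite {1}Vir_bracketC addNr.
Qed.

Let Vir_bracket0 x : Vir_bracket x 0 = 0.
Proof. by rewrite Vir_bracketC /Vir_bracket /lext msupp0 big_nil oppr0. Qed.

Let Vir_bracketZ x a y : Vir_bracket x (a *: y) = a *: Vir_bracket x y.
Proof.
by rewrite -[a *: y]addr0 Vir_bracket_linear_r Vir_bracket0 addr0.
Qed.

Let Vir_bracket_nested m n p :
  Vir_bracket (VirL m) (Vir_bracket (VirL n) (VirL p))
  = ((val n - val p) * (val m - (val n + val p))) *: VirL (m + (n + p))
    + ((val n - val p)
       * ((m + (n + p) == 0)%:R * ((val m ^+ 3 - val m) / 12))) *: VirC.
Proof.
etransitivity; first exact: (congr1 (Vir_bracket _) (Vir_bracketUU _ _)).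
etransitivity; first exact: Vir_bracket_linear_r.
rewrite Vir_bracketZ; have -> : Vir_bracket (VirL m) VirC = 0.
  exact: Vir_bracketUU.
have -> : Vir_bracket (VirL m) (VirL (n + p)) = _ := Vir_bracketUU _ _.
by rewrite scaler0 addr0 scalerDr !scalerA.
Qed.

Let add3_rot (V : zmodType) (a b c : V) : b + c + a = 0 -> a + b + c = 0.
Proof. by rewrite [_ + a]addrC addrA. Qed.

Let add3_scale (V : lmodType K) (x y z u w : V) a b c a' b' c' :
    x = a *: u + a' *: w -> y = b *: u + b' *: w -> z = c *: u + c' *: w ->
  a + b + c = 0 -> a' + b' + c' = 0 -> x + y + z = 0.
Proof.
move=> -> -> -> e e'.
rewrite [X in X + _]addrACA [LHS]addrACA -!scalerDl e e'.
by rewrite !scale0r addr0.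
Qed.

Let Vir_jacobi x y z :
  Vir_bracket x (Vir_bracket y z) + Vir_bracket y (Vir_bracket z x)
    + Vir_bracket z (Vir_bracket x y) = 0.
Proof.
have Bl := Vir_bracket_linear_l; have Br := Vir_bracket_linear_r.
move: x; apply: linear_eq0 => [|i].
  apply: linearDl; last exact: linear_comp (Br z) (Bl y).
  by apply: linearDl; [exact: Bl | exact: linear_comp (Br y) (Br z)].
move: y; apply: linear_eq0 => [|j].
  apply: linearDl; last exact: linear_comp (Br z) (Br _).
  by apply: linearDl; [exact: linear_comp (Br _) (Bl z) | exact: Bl].
move: z; apply: linear_eq0 => [|k].
  apply: linearDl; last exact: Bl.
  by apply: linearDl; [exact: linear_comp (Br _) (Br _)
                      | exact: linear_comp (Br _) (Bl _)].
have B0 (u : Vir Gamma) : Vir_bracket << None >> u = 0.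
  rewrite /Vir_bracket lextU /lext big1 // => l _.
  by rewrite /= scaler0.
have B0' (u : Vir Gamma) : Vir_bracket u << None >> = 0.
  by rewrite Vir_bracketC B0 oppr0.
have cent u v : Vir_bracket VirC (Vir_bracket u v)
    + Vir_bracket u (Vir_bracket v VirC)
    + Vir_bracket v (Vir_bracket VirC u) = 0.
  by rewrite B0 -[Vir_bracket v VirC]/(Vir_bracket v << None >>) B0' B0
             !Vir_bracket0 !addr0.
case: i => [m|]; last exact: cent.
case: j => [n|]; last by apply: add3_rot; exact: cent.
case: k => [p|]; last by do 2!apply: add3_rot; exact: cent.
have E1 := Vir_bracket_nested m n p; have E2 := Vir_bracket_nested n p m.
have E3 := Vir_bracket_nested p m n.
rewrite (_ : n + (p + m) = m + (n + p)) in E2; last by rewrite addrA addrC.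
rewrite (_ : p + (m + n) = m + (n + p)) in E3; last by rewrite addrC -addrA.
apply: add3_scale E1 E2 E3 _ _; first by ring.
have [/eqP|] := eqVneq (m + (n + p)) 0; last by rewrite !mul0r !mulr0 !addr0.
rewrite addr_eq0 => /eqP ->.
rewrite (_ : val (- (n + p)) = - (val n + val p)); last first.
  by rewrite raddfN /= raddfD.
by field.
Qed.

HB.instance Definition _ := Lmodule_isLieAlgebra.Build K (Vir Gamma)
  Vir_bracket_linear_l Vir_bracket_linear_r Vir_bracket_alt Vir_jacobi.

Lemma bracketLL (m n : subgrp Gamma) :
  bracket (VirL m) (VirL n)
  = (val m - val n) *: VirL (m + n)
    + ((m + n == 0)%:R * ((val m ^+ 3 - val m) / 12)) *: VirC.
Proof. exact: Vir_bracketUU. Qed.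

Lemma bracketLC (m : subgrp Gamma) : bracket (VirL m) VirC = 0.
Proof. exact: Vir_bracketUU. Qed.

(* The space K[L_0], with L_0 written 'X. *)
Definition Omega (f : dual Gamma) (alpha : K) : Type := {poly K}.

HB.instance Definition _ f alpha := GRing.Lmodule.on (Omega f alpha).

End Virasoro.

Section OmegaModule.
Variables (K : numFieldType) (Gamma : zmodClosed K).
Variables (f : dual Gamma) (alpha : K).

Definition Omega_act_basis (i : option (subgrp Gamma)) (P : Omega f alpha) :
    Omega f alpha :=
  if i is Some m then
    f m *: (('X + (val m * alpha)%:P) * (P \Po ('X + (val m)%:P)))
  else 0.

Definition Omega_act (x : Vir Gamma) (P : Omega f alpha) : Omega f alpha :=
  lext (Omega_act_basis^~ P) x.

Let Omega_act_linear_l P : linear (Omega_act^~ P).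
Proof. exact: lext_linear. Qed.

Let Omega_act_linear_r x : linear (Omega_act x).
Proof.
move=> a P Q; rewrite /Omega_act -lext_hlinear; apply: eq_lext => -[m|] /=.
  rewrite linearP /= mulrDr scalerDr; congr (_ + _).
  by rewrite -scalerAr !scalerA mulrC.
by rewrite scaler0 addr0.
Qed.

Let Omega_act0 x : Omega_act x 0 = 0.
Proof.
have := Omega_act_linear_r x 1 0 0; rewrite !scale1r !addr0 => h.
by apply: (addrI (Omega_act x 0)); rewrite addr0 -h.
Qed.

Let Omega_actZ x a P : Omega_act x (a *: P) = a *: Omega_act x P.
Proof. by rewrite -[a *: P]addr0 Omega_act_linear_r Omega_act0 addr0. Qed.

Let Omega_actL m P : Omega_act (VirL m) P = Omega_act_basis (Some m) P.
Proof. exact: lextU. Qed.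

Let Omega_actC P : Omega_act (VirC Gamma) P = 0.
Proof. exact: lextU. Qed.

Let Omega_actLL m n P :
  Omega_act (VirL m) (Omega_act (VirL n) P) = dual_fun f (m + n) *:
    (('X + (val m * alpha)%:P) * (('X + (val m)%:P) + (val n * alpha)%:P)
     * (P \Po ('X + (val (m + n))%:P))).
Proof.
etransitivity; first exact: (congr1 (Omega_act _) (Omega_actL _ _)).
etransitivity; first exact: Omega_actZ.
etransitivity; first exact: (congr1 (GRing.scale _) (Omega_actL _ _)).
rewrite /Omega_act_basis.
rewrite scalerA dualD [f n * _]mulrC; congr (_ *: _).
rewrite comp_polyM comp_polyD comp_polyX comp_polyC -comp_polyA.
rewrite comp_polyD comp_polyX comp_polyC mulrA.
by rewrite (_ : val (m + n) = val m + val n) ?polyCD ?addrA //; exact: raddfD.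
Qed.

Let Omega_act_bracketLL m n P :
  Omega_act (bracket (VirL m) (VirL n)) P
  = Omega_act (VirL m) (Omega_act (VirL n) P)
    - Omega_act (VirL n) (Omega_act (VirL m) P).
Proof.
have -> : bracket (VirL m) (VirL n) = Vir_bracket_basis (Some m) (Some n).
  by rewrite /bracket /= /Vir_bracket !lextU.
have -> : Omega_act (Vir_bracket_basis (Some m) (Some n)) P
        = (val m - val n) *: Omega_act (VirL (m + n)) P.
  rewrite /Vir_bracket_basis Omega_act_linear_l.
  have -> : forall a, Omega_act (a *: VirC Gamma) P = 0; last by rewrite addr0.
  move=> a; have := Omega_act_linear_l P a (VirC Gamma) 0.
  rewrite addr0 Omega_actC scaler0 add0r => ->.
  by rewrite /Omega_act /lext msupp0 big_nil.
etransitivity; first exact: (congr1 (GRing.scale _) (Omega_actL _ _)).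
symmetry; etransitivity.
  exact: (congr2 (fun A B => A - B) (Omega_actLL _ _ _) (Omega_actLL _ _ _)).
rewrite /Omega_act_basis [n + m]addrC; symmetry.
rewrite -scalerBr -mulrBl scalerA mulrC -scalerA; congr (_ *: _).
rewrite scalerAl; congr (_ * _).
rewrite (_ : val (m + n) = val m + val n); last exact: raddfD.
rewrite -mul_polyC mulrDl !polyCB !polyCD !polyCM.
by ring.
Qed.

Let Omega_act_bracket x y P :
  Omega_act (bracket x y) P
  = Omega_act x (Omega_act y P) - Omega_act y (Omega_act x P).
Proof.
have B0 (u : Vir Gamma) : bracket (VirC Gamma) u = 0.
  rewrite /bracket /= /Vir_bracket lextU /lext big1 // => l _.
  by rewrite /= scaler0.
have B0' (u : Vir Gamma) : bracket u (VirC Gamma) = 0.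
  rewrite /bracket /= /Vir_bracket /lext big1 // => -[l|] _.
    by rewrite -/(lext _ _) lextU scaler0.
  by rewrite -/(lext _ _) lextU scaler0.
have A0 : Omega_act 0 P = 0 by rewrite /Omega_act /lext msupp0 big_nil.
move: x; apply: linear_eq => [a u v|a u v|i].
- by rewrite bracket_linear_l Omega_act_linear_l.
- rewrite !Omega_act_linear_l Omega_act_linear_r scalerBr opprD.
  by rewrite addrACA.
move: y; apply: linear_eq => [a u v|a u v|j].
- by rewrite bracket_linear_r Omega_act_linear_l.
- rewrite !Omega_act_linear_l Omega_act_linear_r scalerBr opprD.
  by rewrite addrACA.
case: i => [m|]; last by rewrite B0 A0 !Omega_actC Omega_act0 subr0.
case: j => [n|]; last by rewrite B0' A0 !Omega_actC Omega_act0 subr0.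
exact: Omega_act_bracketLL.
Qed.

HB.instance Definition _ := Lmodule_isLieModule.Build K (Vir Gamma)
  (Omega f alpha) Omega_act_linear_l Omega_act_linear_r Omega_act_bracket.

Lemma Omega_actVirL (m : subgrp Gamma) (P : Omega f alpha) :
  act (VirL m) P
  = f m *: (('X + (val m * alpha)%:P) * (P \Po ('X + (val m)%:P))).
Proof. exact: Omega_actL. Qed.

Lemma Omega_actVirC (P : Omega f alpha) : act (VirC Gamma) P = 0.
Proof. exact: Omega_actC. Qed.

End OmegaModule.

(* Main.v *)
From HB Require Import structures.
Require Import Defs.
From mathcomp Require Import all_boot all_order all_algebra.
From mathcomp Require Import reals complex monalg.
From mathcomp Require Import ring zify.

Set Implicit Arguments.
Unset Strict Implicit.
Unset Printing Implicit Defensive.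

Import GRing.Theory Num.Theory.
Local Open Scope ring_scope.

(** Let M be free of rank 1 over K[L_0], with generator v.  Since
    [L_0, L_m] = - m L_m, the operator L_m moves past a polynomial in L_0 by
    translating it: L_m (P v) = P(X + m) (L_m v).  So the module is determined
    by the polynomials a_m and c with L_m v = a_m v and C v = c v, and the
    brackets become the equations
      a_n(X + m) a_m - a_m(X + n) a_n
        = (m - n) a_(m+n) + delta_(m+n,0) (m^3 - m) / 12 c,
      c(X + m) a_m = c a_m,     a_0 = X.
    The theorem is that their solutions are c = 0, a_m = f(m) (X + m alpha)
    with f a character ([structure_solution]).  The steps are as follows.

    - c is constant ([central_const]): at n = - m = - 1 the cocycle vanishes,
      which forces a_1 <> 0, so that c is invariant under X -> X + 1.
    - Every a_m has degree 1 ([size_a]).  For m <> 0 the bracket of L_m and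
      L_(-m) says that the difference F(X + m) - F(X) of
      F = a_m(X - m) a_(-m) is 2 m X + constant, so F has degree 2 and the
      degrees of a_m and a_(-m) add up to 2.  If a_m were a constant, a_(-m)
      would have degree 2, and the bracket of L_m and L_(-2m) would make the
      difference of a_(-2m) a nonzero multiple of a_(-m), giving a_(-2m)
      degree 3.
    - Write a_m = f(m) (X + b(m)).  The coefficients of X show that f is
      multiplicative; the constant ones give
        m b(m) - n b(n) = (m - n) b(m + n) + delta_(m+n,0) (m^3 - m) / 12 c.
      Its instances at the indices 1, -1, 2, -2 force c = 0
      ([central_eq0]), and then its instances with n = 1 and n = - 1 force
      b(m) = m b(1) ([b_linear]).

    The isomorphism onto Omega(f, b(1)) sends P v to P. *)

(** * Translation of polynomials *)

Definition shift (K : nzRingType) (h : K) (p : {poly K}) : {poly K} :=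
  p \Po ('X + h%:P).

Section Shift.
Variable K : comNzRingType.
Implicit Types (p q : {poly K}) (h k : K).

Lemma shiftD h p q : shift h (p + q) = shift h p + shift h q.
Proof. exact: comp_polyD. Qed.

Lemma shiftM h p q : shift h (p * q) = shift h p * shift h q.
Proof. exact: comp_polyM. Qed.

Lemma shiftZ h a p : shift h (a *: p) = a *: shift h p.
Proof. exact: comp_polyZ. Qed.

Lemma shiftC h a : shift h a%:P = a%:P.
Proof. exact: comp_polyC. Qed.

Lemma shiftX h : shift h 'X = 'X + h%:P.
Proof. exact: comp_polyX. Qed.

Lemma shift0 p : shift 0 p = p.
Proof. by rewrite /shift addr0 comp_polyXr. Qed.

Lemma shift_shiftN h p : shift h (shift (- h) p) = p.
Proof. by have := comp_polyXaddC_K p (- h); rewrite -polyCN opprK. Qed.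

End Shift.

Section ShiftSize.
Variable K : numFieldType.
Implicit Types (p : {poly K}) (h : K).

Lemma shift_eq0 h p : (shift h p == 0) = (p == 0).
Proof. exact: comp_poly2_eq0 (size_XaddC h). Qed.

Lemma size_shift h p : size (shift h p) = size p.
Proof. exact: size_comp_poly2 (size_XaddC h). Qed.

Lemma size_deriv_char0 p : size p^`() = (size p).-1.
Proof.
have [->|p0] := eqVneq p 0; first by rewrite linear0 size_poly0.
apply/eqP; rewrite eqn_leq size_poly /=.
case sp: (size p) => [|[|n]] //=; rewrite ltnNge; apply/negP => dn.
have := lead_coef_eq0 p; rewrite (negPf p0) lead_coefE sp /=.
have /eqP := nth_default 0 dn.
by rewrite coef_deriv mulrn_eq0 /= => ->.
Qed.

(** The difference operator lowers the degree by exactly one.  It commutes with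
    the derivative, which does the same in characteristic 0; this reduces the
    claim, by induction, to polynomials of degree at most 1. *)
Lemma size_shiftB h p : h != 0 -> size (shift h p - p) = (size p).-1.
Proof.
move=> h0; elim: {p}(size p) {-2}p (erefl (size p)) => [|n IHn] p sp.
  move/eqP: sp; rewrite size_poly_eq0 => /eqP ->.
  by rewrite /shift comp_poly0 subr0 size_poly0.
case: n => [|n] in IHn sp *.
  have /size_poly1P [c _ ->] : size p == 1 by rewrite sp.
  by rewrite shiftC subrr size_poly0 size_polyC; case: (_ != 0).
have: size (shift h p - p)^`() = n.
  rewrite derivB /shift deriv_comp derivD derivX derivC addr0 mulr1.
  by rewrite IHn ?size_deriv_char0 sp.
rewrite sp size_deriv_char0; case: n => [|n] in IHn sp *.
  suff : shift h p - p != 0.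
    by rewrite -size_poly_gt0; case: (size _) => [|[]].
  have -> : p = p`_1 *: 'X + (p`_0)%:P.
    apply/polyP => -[|[|i]]; rewrite !coefE ?mulr0 ?mulr1 ?add0r ?addr0 //.
    by rewrite nth_default // sp.
  rewrite shiftD shiftC shiftZ shiftX scalerDr opprD addrACA subrr addr0.
  rewrite addrAC subrr add0r scaler_eq0 polyC_eq0 (negPf h0) orbF.
  by have := lead_coef_eq0 p; rewrite lead_coefE sp -size_poly_eq0 sp => ->.
by case: (size (shift h p - p)) => //= k ->.
Qed.
Lemma size_lin_addC (k d : K) : k != 0 -> size (k *: 'X + d%:P) = 2.
Proof.
by move=> k0; rewrite size_polyDl size_scale ?size_polyX ?size_polyC //;
   case: (_ != 0).
Qed.

End ShiftSize.

(** * Solution of the structure equations *)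

Section StructureEquations.
Variables (K : numFieldType) (Gamma : zmodClosed K).
Hypothesis Gamma1 : 1 \in Gamma.
Variables (a : subgrp Gamma -> {poly K}) (c : {poly K}).
Hypothesis a_0 : a 0 = 'X.
Hypothesis a_bracket : forall m n,
  shift (val m) (a n) * a m - shift (val n) (a m) * a n
  = (val m - val n) *: a (m + n)
    + ((m + n == 0)%:R * ((val m ^+ 3 - val m) / 12)) *: c.
Hypothesis a_central : forall m, shift (val m) c * a m = c * a m.

Implicit Types m n : subgrp Gamma.

Let one : subgrp Gamma := Sub 1 Gamma1.

Let valD m n : val (m + n) = val m + val n. Proof. exact: raddfD. Qed.
Let valN m : val (- m) = - val m. Proof. exact: raddfN. Qed.
Let val0 : val (0 : subgrp Gamma) = 0. Proof. exact: raddf0. Qed.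
Let val1 : val one = 1. Proof. by []. Qed.
Let val_eq0 m : (val m == 0) = (m == 0).
Proof. by rewrite -val0 (inj_eq val_inj). Qed.

Lemma a_bracketN m :
  shift (val m) (a (- m)) * a m - shift (- val m) (a m) * a (- m)
  = (2 * val m) *: 'X + ((val m ^+ 3 - val m) / 12) *: c.
Proof.
by rewrite -valN a_bracket subrr eqxx a_0 valN opprK mul1r -mulr2n mulr_natl.
Qed.

(** A nonzero [a one] makes the constancy of [c] follow from its invariance
    under translation by 1; at [one] the cocycle vanishes, so that a zero
    [a one] would make the right-hand side of [a_bracketN] equal to 2 X. *)
Lemma central_const : exists d, c = d%:P.
Proof.
have a1_neq0 : a one != 0.
  apply/eqP => a1; have := a_bracketN one.
  rewrite a1 val1 expr1n subrr !mul0r scale0r addr0 /shift comp_poly0 mul0r.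
  move/esym/eqP.
  by rewrite mulr0 subrr scaler_eq0 polyX_eq0 orbF mulr1 pnatr_eq0.
have := mulIf a1_neq0 (a_central one).
rewrite val1 => c1; exists c`_0; apply: size1_polyC.
have := size_shiftB c (oner_neq0 K).
by rewrite c1 subrr size_poly0; case: (size c) => [|[]].
Qed.

(** The difference of the product [shift (- val m) (a m) * a (- m)] has degree 1
    by [a_bracketN], so that the product has degree 2. *)
Lemma size_aN m : m != 0 -> (size (a m) + size (a (- m)) = 4)%N
  /\ (0 < size (a m))%N /\ (0 < size (a (- m)))%N.
Proof.
move=> m0; have [d c_d] := central_const.
pose F := shift (- val m) (a m) * a (- m).
have : size (shift (val m) F - F) = 2.
  rewrite /F shiftM shift_shiftN mulrC a_bracketN c_d.
  rewrite -[_ *: d%:P]mul_polyC -polyCM.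
  by rewrite size_lin_addC // mulf_neq0 ?pnatr_eq0 ?val_eq0.
rewrite size_shiftB ?val_eq0 // => sF.
have F0 : F != 0 by rewrite -size_poly_eq0; case: (size F) sF.
move: (F0); rewrite mulf_eq0 negb_or => /andP[am0 aN0].
move: sF; rewrite size_mul // size_shift.
move: am0 aN0; rewrite shift_eq0 -!size_poly_gt0.
move: (size (a m)) (size (a (- m))) => k l; lia.
Qed.

(** A constant [a m] would let [a (- (m + m))] exceed the degree bound of
    [size_aN]. *)
Lemma size_a_neq1 m : m != 0 -> size (a m) <> 1.
Proof.
move=> m0 am1; have m2 : m + m != 0.
  by rewrite -val_eq0 valD -mulr2n mulrn_eq0 val_eq0.
have [s4 _] := size_aN m0; have [s4' [p1 _]] := size_aN m2.
have /size_poly1P [k k0 am] : size (a m) == 1 by rewrite am1.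
have := a_bracket m (- (m + m)).
have -> : m - (m + m) = - m by rewrite opprD addNKr.
rewrite oppr_eq0 (negPf m0) mul0r scale0r addr0 am shiftC.
rewrite mulrC -mulrBr mul_polyC => E.
have := congr1 (fun p : {poly K} => size p) E.
rewrite size_scale // size_shiftB ?val_eq0 //.
rewrite size_scale; last first.
  rewrite valN valD opprK -mulr2n addrC -mulrSr mulrn_eq0 /=.
  by rewrite val_eq0.
move: s4 s4' p1; rewrite am1.
move: (size (a (- m))) (size (a (m + m))) (size (a (- (m + m)))) => t u v; lia.
Qed.

Lemma size_a m : size (a m) = 2.
Proof.
have [->|m0] := eqVneq m 0; first by rewrite a_0 size_polyX.
have mN0 : - m != 0 by rewrite oppr_eq0.
move: (size_a_neq1 m0) (size_a_neq1 mN0) (size_aN m0).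
move: (size (a m)) (size (a (- m))) => u v; lia.
Qed.

Let f m := (a m)`_1.
Let b m := (a m)`_0 / (a m)`_1.

Let f_neq0 m : f m != 0.
Proof.
have := lead_coef_eq0 (a m); rewrite lead_coefE size_a /= -/(f m) => ->.
by rewrite -size_poly_eq0 size_a.
Qed.

Let aE m : a m = f m *: ('X + (b m)%:P).
Proof.
apply/polyP => -[|[|i]]; rewrite !coefE ?add0r ?addr0 ?mulr1 //.
  by rewrite mulrCA divff ?mulr1.
by rewrite mulr0 nth_default // size_a.
Qed.

Let f0 : f 0 = 1. Proof. by rewrite /f a_0 coefX. Qed.
Let b0 : b 0 = 0. Proof. by rewrite /b a_0 !coefX mul0r. Qed.

Lemma coef_bracket d m n : c = d%:P ->
  f m * f n * (val m - val n) = (val m - val n) * f (m + n) /\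
  f m * f n * (val m * b m - val n * b n)
  = (val m - val n) * (f (m + n) * b (m + n))
    + (m + n == 0)%:R * ((val m ^+ 3 - val m) / 12) * d.
Proof.
move=> c_d; have := a_bracket m n; rewrite !aE c_d !shiftZ !shiftD !shiftX.
rewrite !shiftC => E.
have {}E : (f m * f n) *:
     ((val m - val n) *: 'X + (val m * b m - val n * b n)%:P) =
   (val m - val n) *: (f (m + n) *: ('X + (b (m + n))%:P)) +
   (((m + n == 0)%:R * ((val m ^+ 3 - val m) / 12)) * d)%:P.
  rewrite (_ : (_ * d)%:P
    = ((m + n == 0)%:R * ((val m ^+ 3 - val m) / 12)) *: d%:P); last first.
    by rewrite polyCM mul_polyC.
  rewrite -E -!mul_polyC !(polyCM, polyCB); ring.
split.
  have := congr1 (fun p : {poly K} => p`_1) E.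
  by rewrite !coefE /= !(mulr1, addr0).
have := congr1 (fun p : {poly K} => p`_0) E.
by rewrite !coefE /= !(mulr0, add0r).
Qed.

(* [coef_bracket] gives multiplicativity for m <> n; on the diagonal it comes
   from the pairs (2m, -m) and (m, -m). *)
Let fD m n : f (m + n) = f m * f n.
Proof.
have [d c_d] := central_const.
have neqD k l : k != l -> f (k + l) = f k * f l.
  move=> kl; have [E _] := coef_bracket k l c_d.
  have kl0 : val k - val l != 0 by rewrite subr_eq0 (inj_eq val_inj).
  by apply: (mulfI kl0); rewrite -E mulrC.
have [<-|] := eqVneq m n; last exact: neqD.
have [->|m0] := eqVneq m 0; first by rewrite addr0 f0 mulr1.
have v0 : val m != 0 by rewrite val_eq0.
have e1 : f (m + m - m) = f (m + m) * f (- m).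
  apply: neqD; rewrite -subr_eq0 opprK -val_eq0 !valD.
  by rewrite -mulr2n -mulrSr mulrn_eq0.
have e2 : f (m - m) = f m * f (- m).
  apply: neqD; rewrite -subr_eq0 opprK -val_eq0 !valD.
  by rewrite -mulr2n mulrn_eq0.
apply: (mulIf (f_neq0 (- m))).
by rewrite -e1 -mulrA -e2 subrr f0 mulr1 addrK.
Qed.

Let bD d m n : c = d%:P ->
  val m * b m - val n * b n = (val m - val n) * b (m + n)
    + (m + n == 0)%:R * ((val m ^+ 3 - val m) / 12) * d.
Proof.
move=> c_d; have [_] := coef_bracket m n c_d.
have [e|] := eqVneq (m + n) 0; last first.
  rewrite !mul0r !addr0 -fD => _; rewrite [RHS]mulrCA.
  exact: (mulfI (f_neq0 _)).
by rewrite -fD e f0 !mul1r.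
Qed.

(** With s(k) = b(k) + b(-k), the relation at (k, -k) gives
    12 s(k) = (k^2 - 1) c, while the difference of those at (1, -2) and (-1, 2) gives
    s(1) = s(2). *)
Lemma central_eq0 : c = 0.
Proof.
have [d c_d] := central_const; rewrite c_d.
have n1 : (one == 0) = false by rewrite -val_eq0 oner_eq0.
have bN k : k%:R * (b (one *+ k) + b (- (one *+ k)))
    = (k%:R ^+ 3 - k%:R) / 12 * d.
  have := bD (one *+ k) (- (one *+ k)) c_d.
  rewrite subrr b0 eqxx mulr0 add0r mul1r valN mulNr opprK -mulrDr.
  by rewrite raddfMn.
have b1 := bD one (- (one *+ 2)) c_d.
have b2 := bD (- one) (one *+ 2) c_d.
have e1 : one - one *+ 2 = - one by rewrite mulr2n opprD addNKr.
have e2 : - one + one *+ 2 = one by rewrite mulr2n addKr.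
rewrite e1 oppr_eq0 !n1 !mul0r addr0 in b1.
rewrite e2 !n1 !mul0r addr0 in b2.
move: (bN 1%N) (bN 2%N) b1 b2; rewrite !valN raddfMn !val1.
rewrite mulr1n.
move: (b one) (b (- one)) (b (one *+ 2)) (b (- (one *+ 2))) => x y z t.
move=> E1 E2 E3 E4.
(* d is a combination of the four relations. *)
have -> : d = - 2 * (2 * (z + t) - (2 ^+ 3 - 2) / 12 * d)
    + 2 * (1 * x - - 2 * t - (1 - - 2) * y)
    - 2 * (- 1 * y - 2 * z - (- 1 - 2) * x)
    + 4 * (1 * (x + y) - (1 ^+ 3 - 1) / 12 * d) by field.
by rewrite E1 E2 E3 E4 !subrr !mulr0 !addr0 subrr.
Qed.

(** Eliminating [b (m + one)] between the relations at (m, 1) and (m + 1, -1)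
    leaves 2 b(m) = 2 m b(1), even where a factor m - 1 or m + 1 vanishes. *)
Lemma b_linear m : b m = val m * b one.
Proof.
have E k l : val k * b k - val l * b l = (val k - val l) * b (k + l).
  by rewrite (@bD 0) ?mulr0 ?addr0 // central_eq0.
have bN : b (- one) = - b one.
  have := E one (- one); rewrite subrr b0 mulr0 valN val1 mulN1r opprK mul1r.
  by rewrite addrC => /eqP; rewrite addr_eq0 => /eqP.
have E1 := E m one; have E2 := E (m + one) (- one).
rewrite addrK bN valD valN val1 in E1 E2.
have two : (2 : K) != 0 by rewrite pnatr_eq0.
apply: (mulfI two).
move: (val m) (b m) (b one) (b (m + one)) E1 E2 => x y z t E1 E2.
apply/eqP; rewrite -subr_eq0; apply/eqP.
(* (m + 1) times the first relation plus (m - 1) times the second. *)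
have -> : 2 * y - 2 * (x * z) = (x + 1) * (x * y - 1 * z - (x - 1) * t)
    + (x - 1) * ((x + 1) * t - - 1 * - z - (x + 1 - - 1) * y) by ring.
by rewrite E1 E2 !subrr !mulr0 addr0.
Qed.

Lemma structure_solution :
  c = 0 /\ exists (g : dual Gamma) (alpha : K),
    forall m, a m = g m *: ('X + (val m * alpha)%:P).
Proof.
split; first exact: central_eq0.
exists (Dual f_neq0 fD), (b one) => m.
by rewrite -b_linear -aE.
Qed.

End StructureEquations.

(** * Modules free of rank one over a one-variable enveloping algebra *)

(** Freeness only asserts that coordinates exist.  Equality in [N] is boolean
    and [A] is a choice type, so that [xchoose] turns this into a function. *)
Lemma free_rank1_iso (A : nzRingType) (N : lmodType A) : free_of_rank N 1 ->
  exists phi : {linear N -> A^o}, bijective phi.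
Proof.
case=> b bP.
have ex w : exists k, w == k *: b ord0.
  have [e [/eqP we _]] := bP w; exists (e ord0).
  by rewrite big_ord1 in we.
have uniq k l : k *: b ord0 = l *: b ord0 -> k = l.
  move=> kl; have [e [_ eU]] := bP (k *: b ord0).
  have := eU [ffun => k]; rewrite big_ord1 ffunE => /(_ erefl) ek.
  have := eU [ffun => l]; rewrite big_ord1 ffunE kl => /(_ erefl) el.
  by have := congr1 (fun h : {ffun _} => h ord0) ek;
    rewrite el !ffunE => ->.
pose phi w : A^o := xchoose (ex w).
have phiP w : w = phi w *: b ord0 by exact/eqP/(xchooseP (ex w)).
have phi_linear : linear phi.
  move=> k u v; apply: uniq.
  by rewrite -phiP scalerDl -scalerA -!phiP.
pose lphi := GRing.isLinear.Build A N A^o *:%R phi phi_linear.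
exists (HB.pack phi lphi : {linear N -> A^o}).
exists (fun k => k *: b ord0) => [w|k] /=; first by rewrite -phiP.
by apply: uniq; rewrite -phiP.
Qed.

Section LieModuleTheory.
Variables (K : fieldType) (g : lieAlgType K) (M : lieModType g).
Implicit Types (x y : g) (v w : M) (k : K).

Lemma actDr x v w : act x (v + w) = act x v + act x w.
Proof. by have := act_linear_r x 1 v w; rewrite !scale1r. Qed.

Lemma act0r x : act x (0 : M) = 0.
Proof. by apply: (addrI (act x 0)); rewrite -actDr !addr0. Qed.

Lemma actZr x k v : act x (k *: v) = k *: act x v.
Proof. by rewrite -[k *: v]addr0 act_linear_r act0r addr0. Qed.

Lemma act0l v : act (0 : g) v = 0.
Proof.
have := act_linear_l v 1 (0 : g) 0; rewrite !scale1r addr0 => e.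
by apply: (addrI (act 0 v)); rewrite addr0 -e.
Qed.

Lemma actZl x k v : act (k *: x) v = k *: act x v.
Proof. by rewrite -[k *: x]addr0 act_linear_l act0l addr0. Qed.

Lemma restr_scale_polyC x k v :
  k%:P *: (v : restr x M) = (k *: v : M) :> restr x M.
Proof.
rewrite -[LHS]/(restr_scale _ _) /restr_scale size_polyC.
have [->|k0] := eqVneq k 0; first by rewrite big_ord0 scale0r.
by rewrite big_ord1 coefC.
Qed.

(** The hypothesis is [x, y] = - k y as operators on the module: y then carries
    multiplication by x to multiplication by x + k. *)
Lemma act_shift x y k :
  (forall v, act y (act x v) = act x (act y v) + k *: act y v) ->
  forall (p : {poly K}) (v : restr x M),
  act y (p *: v : M) = shift k p *: (act y v : restr x M).
Proof.
move=> xy p v; elim/poly_ind: p => [|p a IHp].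
  by rewrite /shift comp_poly0 !scale0r; exact: act0r.
rewrite shiftD shiftM shiftX shiftC !scalerDl.
etransitivity; first exact: actDr.
congr (_ + _); last first.
  rewrite restr_scale_polyC; etransitivity; first exact: actZr.
  by rewrite restr_scale_polyC.
rewrite [p * _]mulrC -scalerA restr_scaleX xy IHp mulrC -scalerA scalerDl.
by rewrite restr_scaleX restr_scale_polyC.
Qed.

End LieModuleTheory.

(** * Classification over the Virasoro algebra of Gamma *)

Section VirModule.
Variables (K : numFieldType) (Gamma : zmodClosed K) (M : lieModType (Vir Gamma)).
Implicit Types (m : subgrp Gamma) (v w : M).
Local Notation L0 := (VirL (0 : subgrp Gamma)).

Lemma act_VirLL m n v :
  act (VirL m) (act (VirL n) v) - act (VirL n) (act (VirL m) v)
  = (val m - val n) *: act (VirL (m + n)) v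
    + ((m + n == 0)%:R * ((val m ^+ 3 - val m) / 12)) *: act (VirC Gamma) v.
Proof.
transitivity (act (bracket (VirL m) (VirL n)) v).
  by rewrite act_bracket.
etransitivity; first exact: (congr1 (act^~ v) (bracketLL m n)).
etransitivity; first exact: act_linear_l.
congr (_ + _); exact: actZl.
Qed.

Lemma act_VirC m v :
  act (VirL m) (act (VirC Gamma) v) = act (VirC Gamma) (act (VirL m) v).
Proof.
apply/eqP; rewrite -subr_eq0 -act_bracket; apply/eqP.
etransitivity; first exact: (congr1 (act^~ v) (bracketLC m)).
exact: act0l.
Qed.

Lemma act_VirL_scale m (p : {poly K}) (v : restr L0 M) :
  act (VirL m) (p *: v : M)
  = shift (val m) p *: (act (VirL m) v : restr L0 M).
Proof.
have val0 : val (0 : subgrp Gamma) = 0 by exact: raddf0.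
apply: act_shift => {}v; apply/eqP; rewrite addrC -subr_eq; apply/eqP.
(* At n = 0 the cocycle is supported at m = 0, where m^3 - m vanishes. *)
have no_cocycle : (m + 0 == 0)%:R * ((val m ^+ 3 - val m) / 12) = 0 :> K.
  rewrite addr0; have [->|_] := eqVneq m 0; last by rewrite mul0r.
  by rewrite val0 expr0n subrr mul0r mulr0.
have := act_VirLL m 0 v.
rewrite no_cocycle val0 addr0 subr0 => ->.
by rewrite [X in _ + X]scale0r addr0.
Qed.

Lemma act_VirC_scale (p : {poly K}) (v : restr L0 M) :
  act (VirC Gamma) (p *: v : M) = p *: (act (VirC Gamma) v : restr L0 M).
Proof.
rewrite -[in RHS](shift0 p); apply: act_shift => {}v.
by rewrite act_VirC scale0r addr0.
Qed.

Lemma act_hom_VirLC (N : lieModType (Vir Gamma)) (phi : {linear M -> N}) :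
  (forall m v, phi (act (VirL m) v) = act (VirL m) (phi v)) ->
  (forall v, phi (act (VirC Gamma) v) = act (VirC Gamma) (phi v)) ->
  forall x v, phi (act x v) = act x (phi v).
Proof.
move=> hL hC x v; move: x; apply: linear_eq => [k x y|k x y|[m|]].
- by rewrite act_linear_l linearP.
- exact: act_linear_l.
- exact: hL.
- exact: hC.
Qed.

Lemma free_rank1_classification : 1 \in Gamma -> free_of_rank (restr L0 M) 1 ->
  (forall v, act (VirC Gamma) v = 0) /\
  exists (f : dual Gamma) (alpha : K), lieMod_isomorphic M (Omega f alpha).
Proof.
move=> Gamma1 /free_rank1_iso [phi [psi phiK psiK]].
pose v0 := psi 1.
have phi_v0 : phi v0 = 1 by rewrite psiK.
have gen (w : restr L0 M) : w = (phi w : {poly K}) *: v0.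
  by apply: (can_inj phiK); rewrite linearZ /= phi_v0 [RHS]mulr1.
(* The polynomials by which L_m and C act on the generator. *)
pose a m : {poly K} := phi (act (VirL m) (v0 : M)).
pose c : {poly K} := phi (act (VirC Gamma) (v0 : M)).
have phiL m (w : M) : phi (act (VirL m) w) = shift (val m) (phi w) * a m.
  by rewrite {1}[w]gen act_VirL_scale linearZ.
have phiC (w : M) : phi (act (VirC Gamma) w) = (phi w : {poly K}) * c.
  by rewrite {1}[w]gen act_VirC_scale linearZ.
have phiZ k (w : M) : phi (k *: w : M) = k *: (phi w : {poly K}).
  by rewrite -[X in phi X]restr_scale_polyC linearZ /= [LHS]mul_polyC.
have phiD (u w : M) : phi (u + w : M) = (phi u : {poly K}) + phi w.
  exact: raddfD.
have a_0 : a 0 = 'X.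
  by rewrite /a -restr_scaleX linearZ /= phi_v0 [LHS]mulr1.
have a_bracket m n : shift (val m) (a n) * a m - shift (val n) (a m) * a n
  = (val m - val n) *: a (m + n)
    + ((m + n == 0)%:R * ((val m ^+ 3 - val m) / 12)) *: c.
  transitivity
    (phi (act (VirL m) (act (VirL n) v0) - act (VirL n) (act (VirL m) v0) : M)).
    symmetry; etransitivity; first exact: raddfB.
    congr (_ - _); exact: phiL.
  etransitivity; first exact: (congr1 phi (act_VirLL m n v0)).
  etransitivity; first exact: phiD.
  congr (_ + _); exact: phiZ.
have a_central m : shift (val m) c * a m = c * a m.
  by rewrite -phiL act_VirC phiC mulrC.
have [c0 [f [alpha aE]]] := structure_solution Gamma1 a_0 a_bracket a_central.
have C0 (v : M) : act (VirC Gamma) v = 0.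
  by apply: (can_inj phiK); rewrite phiC c0 mulr0 [RHS]raddf0.
split=> //; exists f, alpha.
have phi_linear : linear (phi : M -> Omega f alpha).
  move=> k u v; etransitivity; first exact: phiD.
  congr (_ + _); exact: phiZ.
pose lphi := GRing.isLinear.Build K M (Omega f alpha) *:%R phi phi_linear.
exists (HB.pack (phi : M -> Omega f alpha) lphi : {linear M -> Omega f alpha}).
split; first by exists psi.
apply: act_hom_VirLC => [m v|v] /=.
  by rewrite Omega_actVirL phiL aE -scalerAr mulrC.
by rewrite Omega_actVirC C0 [LHS]raddf0.
Qed.

End VirModule.

Theorem theorem4p1 (R : realType) (Gamma : zmodClosed R[i])
    (Gamma1 : 1 \in Gamma) (M : lieModType (Vir Gamma))
    (freeM : free_of_rank (restr (VirL (0 : subgrp Gamma)) M) 1) :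
  (forall v : M, act (VirC Gamma) v = 0) /\
  exists (f : dual Gamma) (alpha : R[i]), lieMod_isomorphic M (Omega f alpha).
Proof. exact: free_rank1_classification. Qed.
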